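(* For any packing instance of the general MIP (with its tree-structured reformulation), under relatively complete recourse, for $k\in[n]$, $$\eta_k\cdot\mathrm{OPT}\ \le\ \mathrm{DUAL}^M_k\ \le\ \mathrm{OPT}.$$
   Context: $\mathbf{conv}$ denotes convex hull; $\min$ is read as infimum in the extended reals. General MIP: $\min\{c^\top x: Ax\le b,\ x \text{ mixed-binary}\}$ with $n$ variables and rational $c,b,A$, where a prescribed subset of the variables is required to be in $\{0,1\}$ and the others are continuous and non-negative. Its intersection graph $\mathcal{G}$ has one vertex per variable, two vertices being adjacent iff the variables appear in a common constraint of $Ax\le b$. A tree decomposition of $\mathcal{G}$ is a pair $(\mathcal{T},\mathcal{Q})$ with $\mathcal{T}$ a tree and $\mathcal{Q}=\{\mathcal{Q}_t\subseteq V(\mathcal{G}):t\in V(\mathcal{T})\}$ such that: for each $v\in V(\mathcal{G})$ the set $\{t:v\in\mathcal{Q}_t\}$ forms a subtree of $\mathcal{T}$; each edge $(u,v)$ of $\mathcal{G}$ has $u,v\in\mathcal{Q}_t$ for some $t$; and $\bigcup_t\mathcal{Q}_t=V(\mathcal{G})$. Put $\mathcal{Q}_{ij}=\mathcal{Q}_i\cap\mathcal{Q}_j$. Tree-structured reformulation: each block $i\in V(\mathcal{T})$ has local copies $x^{(i)}=(x^{(i)}_v)_{v\in\mathcal{Q}_i}$ of the variables in $\mathcal{Q}_i$ (with the same binary/non-negativity restrictions); each constraint of $Ax\le b$ is assigned to some block whose bag contains all its variables, and $\mathcal{X}^{(i)}$ is the set of $x^{(i)}$ satisfying the constraints assigned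 to block $i$ and these restrictions. The objective is split as $\sum_i\langle c^{(i)},x^{(i)}\rangle$ with $\sum_{i:v\in\mathcal{Q}_i}c^{(i)}_v=c_v$. The problem is $$\mathrm{OPT}=\min\Big\{\sum_{i\in V(\mathcal{T})}\langle c^{(i)},x^{(i)}\rangle:\ x^{(i)}\in\mathcal{X}^{(i)}\ \forall i\in V(\mathcal{T}),\ x^{(i)}_v=x^{(j)}_v\ \forall (i,j)\in E(\mathcal{T}),\,v\in\mathcal{Q}_{ij}\Big\}.$$ Standing assumption: every $v\in\mathcal{Q}_{ij}$, $(i,j)\in E(\mathcal{T})$, is a binary variable. The instance is packing if all $c^{(i)}$ are entrywise non-positive and $A,b$ are entrywise non-negative. Relatively complete recourse (general): for any $i\in V(\mathcal{T})$ and any $\bar x\in\mathcal{X}^{(i)}$ there exists a feasible solution $x_*$ of the tree-structured problem with $x_*^{(i)}=\bar x$. M-Lagrangian dual of level $k$: let $\mathcal{X}^{(i)}_M=\{(x^{(i)},w^{(i)}):x^{(i)}\in\mathcal{X}^{(i)},\ w^{(i)}_S=\prod_{v\in S}x^{(i)}_v\ \forall S\subseteq\mathcal{Q}_i\}$, and let $\mathcal{S}_{ij}=\binom{\mathcal{Q}_{ij}}{\le k}$ be the collection of subsets of $\mathcal{Q}_{ij}$ of cardinality at most $k$. The value of the dual obtained by dualizing $w^{(i)}_S=w^{(j)}_S$, $(i,j)\in E(\mathcal{T})$, $S\in\mathcal{S}_{ij}$, is given by its primal characterization $$\mathrm{DUAL}^M_k=\min\Big\{\sum_{i}\langle c^{(i)},x^{(i)}\rangle:\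 (x^{(i)},w^{(i)})\in\mathbf{conv}\{\mathcal{X}^{(i)}_M\}\ \forall i\in V(\mathcal{T}),\ w^{(i)}_S=w^{(j)}_S\ \forall (i,j)\in E(\mathcal{T}),\,S\in\mathcal{S}_{ij}\Big\}.$$ Good sets: for a subset $\mathcal{W}$ of the variables, let $\mathcal{T}(\mathcal{W})$ be the subgraph of $\mathcal{T}$ induced by $\{i\in V(\mathcal{T}):\mathcal{Q}_i\cap\mathcal{W}\ne\emptyset\}$. $\mathcal{W}$ is good if every connected component $\mathcal{C}$ of $\mathcal{T}(\mathcal{W})$ satisfies either (1) $|\mathcal{Q}_i\cap\mathcal{Q}_j\cap\mathcal{W}|\le k$ for every $(i,j)\in E(\mathcal{C})$, or (2) there exists $i\in V(\mathcal{C})$ with $\mathcal{Q}_j\cap\mathcal{W}\subseteq\mathcal{Q}_i\cap\mathcal{W}$ for all $j\in V(\mathcal{C})$. With $\chi_{\mathcal{W}}$ the $0/1$ indicator vector of $\mathcal{W}$ and $\mathbf{1}$ the all-ones vector, $$\eta_k=\min\Big\{\sum_{\mathcal{W}\text{ good}}\alpha_{\mathcal{W}}:\ \sum_{\mathcal{W}\text{ good}}\alpha_{\mathcal{W}}\chi_{\mathcal{W}}\ge\mathbf{1},\ \alpha\ge 0\Big\}.$$ *)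

(* Defs.v *)
From HB Require Import structures.
From mathcomp Require Import all_boot all_order all_algebra.
From mathcomp Require Import all_classical all_reals ereal.

Set Implicit Arguments.
Unset Strict Implicit.
Unset Printing Implicit Defensive.

Import Order.TTheory GRing.Theory Num.Theory.

Local Open Scope classical_set_scope.
Local Open Scope ring_scope.

Section Trees.
Context {T : finType}.

Definition induced (e : rel T) (S : {set T}) : rel T :=
  [rel x y | [&& x \in S, y \in S & e x y]].

Definition simple_graph (e : rel T) : Prop := symmetric e /\ irreflexive e.

(* [e] is the adjacency relation of a simple graph, so that each edge is a
   [ucycle] of size 2; the graph cycles are the ucycles of size at least 3. *)
Definition induces_tree (e : rel T) (S : {set T}) : Prop :=
  [/\ S != finset.set0,
      {in S &, forall x y, connect (induced e S) x y} &
      forall p : seq T, ucycle (induced e S) p -> (size p <= 2)%N].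

Definition is_tree (e : rel T) : Prop :=
  simple_graph e /\ induces_tree e [set: T]%SET.

Definition tree_decomposition {V : finType} (g : rel V) (e : rel T)
    (Q : T -> {set V}) : Prop :=
  [/\ is_tree e,
      forall v, induces_tree e [set t | v \in Q t]%SET,
      forall u v, g u v -> exists t, u \in Q t /\ v \in Q t &
      (\bigcup_t Q t)%SET = [set: V]%SET].

End Trees.

Definition conv {R : realType} {V : lmodType R} (X : set V) : set V :=
  [set z | exists (p : nat) (lam : 'I_p -> R) (y : 'I_p -> V),
     [/\ forall l, 0 <= lam l, \sum_l lam l = 1, forall l, X (y l) &
         z = \sum_l lam l *: y l]].

(* The problem  min c x  s.t.  A x <= b,  x_v in {0,1} for v in [mip_bin],
   x_v >= 0 for the other variables. *)
Record mip (n m : nat) := Mip {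
  mip_A : 'M[rat]_(m, n);
  mip_b : 'cV[rat]_m;
  mip_c : 'rV[rat]_n;
  mip_bin : {set 'I_n} }.

Definition intersection_graph {n m} (P : mip n m) : rel 'I_n :=
  [rel u v | (u != v) &&
     [exists r : 'I_m, (mip_A P r u != 0) && (mip_A P r v != 0)]].

Section Reformulation.
Context {R : realType} {n m : nat} {T : finType}.
Implicit Types (P : mip n m) (Q : T -> {set 'I_n}) (e : rel T).

Definition bag Q i := {v : 'I_n | v \in Q i}.
Definition subbag Q i := {S : {set 'I_n} | S \subset Q i}.

(* The regular module [R^o] (convertible to [R]) gives these types their
   [lmodType R] structure. *)
Definition xvec Q i := {ffun bag Q i -> R^o}.
Definition wvec Q i := {ffun subbag Q i -> R^o}.

(* [asg r] is the block to which the constraint [r] is assigned. *)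
Definition assignment P Q (asg : 'I_m -> T) : Prop :=
  forall r v, mip_A P r v != 0 -> v \in Q (asg r).

(* The inner sum has one term if [v \in Q i] and none otherwise. *)
Definition objective_split P Q (c : forall i, xvec Q i) : Prop :=
  forall v, \sum_i \sum_(u : bag Q i | val u == v) c i u = ratr (mip_c P 0 v).

Definition block_feasible P Q (asg : 'I_m -> T) i : set (xvec Q i) :=
  [set x | [/\ forall r, asg r = i ->
                 \sum_(u : bag Q i) ratr (mip_A P r (val u)) * x u
                   <= ratr (mip_b P r 0),
               forall u : bag Q i, val u \in mip_bin P -> x u = 0 \/ x u = 1 &
               forall u : bag Q i, val u \notin mip_bin P -> 0 <= x u]].

Definition objective Q (c x : forall i, xvec Q i) : R :=
  \sum_i \sum_(u : bag Q i) c i u * x i u.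

Definition tree_feasible P e Q (asg : 'I_m -> T) (x : forall i, xvec Q i) :
    Prop :=
  (forall i, block_feasible P asg (x i)) /\
  (forall i j, e i j -> forall (u : bag Q i) (u' : bag Q j),
     val u = val u' -> x i u = x j u').

Definition OPT P e Q asg (c : forall i, xvec Q i) : \bar R :=
  ereal_inf [set (objective c x)%:E | x in tree_feasible P e asg].

Definition binary_interfaces P e Q : Prop :=
  forall i j, e i j -> Q i :&: Q j \subset mip_bin P.

Definition packing P Q (c : forall i, xvec Q i) : Prop :=
  [/\ forall i u, c i u <= 0,
      forall r v, 0 <= mip_A P r v &
      forall r, 0 <= mip_b P r 0].

Definition relatively_complete_recourse P e Q (asg : 'I_m -> T) : Prop :=
  forall i (y : xvec Q i), block_feasible P asg y ->
    exists2 x : forall i, xvec Q i, tree_feasible P e asg x & x i = y.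

Definition block_feasibleM P Q (asg : 'I_m -> T) i :
    set (xvec Q i * wvec Q i)%type :=
  [set z : xvec Q i * wvec Q i | block_feasible P asg z.1 /\
     forall S : subbag Q i, z.2 S = \prod_(u : bag Q i | val u \in val S) (z.1 u : R)].

Definition dualM_feasible P e Q (asg : 'I_m -> T) k
    (z : forall i, xvec Q i * wvec Q i) : Prop :=
  (forall i, conv (block_feasibleM P asg (i := i)) (z i)) /\
  (forall i j, e i j -> forall (S : subbag Q i) (S' : subbag Q j),
     val S = val S' -> (#|val S| <= k)%N -> (z i).2 S = (z j).2 S').

Definition DUALM P e Q asg (c : forall i, xvec Q i) k : \bar R :=
  ereal_inf [set (objective c (fun i => (z i).1))%:E
            | z in dualM_feasible P e asg k].

Definition support_nodes Q (W : {set 'I_n}) : {set T} :=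
  [set i | Q i :&: W != finset.set0]%SET.

(* Vertex set of the connected component of [i] in the subgraph induced by
   [support_nodes Q W]; only used for [i] in that set. *)
Definition component e Q W i : {set T} :=
  [set j | connect (induced e (support_nodes Q W)) i j]%SET.

Definition good e Q k (W : {set 'I_n}) : bool :=
  [forall i in support_nodes Q W,
    let C := component e Q W i in
    [forall j in C, [forall l in C, e j l ==> (#|Q j :&: Q l :&: W| <= k)%N]]
    || [exists j in C, [forall l in C, Q l :&: W \subset Q j :&: W]]].

(* Only the values of [alpha] on good sets are relevant. *)
Definition fractional_good_cover e Q k (alpha : {set 'I_n} -> R) : Prop :=
  (forall W, good e Q k W -> 0 <= alpha W) /\
  (forall v, 1 <= \sum_(W | good e Q k W) alpha W * (v \in W)%:R).

Definition eta_cover e Q k : \bar R :=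
  ereal_inf [set (\sum_(W | good e Q k W) alpha W)%:E
            | alpha in fractional_good_cover e Q k].

End Reformulation.

Arguments xvec R {n T} Q i.
Arguments wvec R {n T} Q i.
Arguments relatively_complete_recourse R {n m T} P e Q asg.
Arguments eta_cover R {n T} e Q k.

(* Main.v *)
(** Zeroing the coordinates outside a set W keeps a packing solution feasible, so
    it suffices to show that for good W the cost of the W-part of any dual
    solution z is at least OPT; averaging over a fractional good cover then gives
    the bound, all costs being non-positive. Each block of z is the mean of a
    finite law on feasible block solutions. On a component of T(W) whose
    interfaces meet W in at most k variables, the moments fixed by the dual
    determine the laws of the interface patterns, so the block laws can be glued
    along the tree into one law on solutions consistent on W. On a component with
    a hub, samples of the hub's law are extended by recourse. In both cases some
    sample costs at most the mean, and the components do not interact on W. *)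

Require Import Defs.
From HB Require Import structures.
From mathcomp Require Import all_boot all_order all_algebra.
From mathcomp Require Import all_classical all_reals ereal.
From mathcomp Require Import fintype finset.

Set Implicit Arguments.
Unset Strict Implicit.
Unset Printing Implicit Defensive.

Import Order.TTheory GRing.Theory Num.Theory.

Local Open Scope ring_scope.

(** * Connectivity and the growth of subtrees *)

Section Graph.
Context {T : finType}.
Implicit Types (e : rel T) (D S : {set T}).

Lemma connect_invariant (U : Type) e (f : T -> U) x y :
  (forall a b, e a b -> f a = f b) -> connect e x y -> f x = f y.
Proof.
move=> ef /connectP[p + ->]; elim: p x => //= a p IH x /andP[/ef -> /IH //].
Qed.

Lemma connect_exits e D x y : connect e x y -> x \in D -> y \notin D ->
  exists a b, [/\ a \in D, b \notin D, e a b & connect e x a].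
Proof.
move=> /connectP[p + ->]; elim: p x => [|a p IH] x /=; first by move=> _ ->.
move=> /andP[exa pa] xD lD; have [aD|aD] := boolP (a \in D); last by exists x, a.
have [b [c [bD cD ebc ab]]] := IH a pa aD lD.
by exists b, c; split=> //; apply: connect_trans ab; apply: connect1.
Qed.

Lemma induced_connect_sym e S : symmetric e -> connect_sym (induced e S).
Proof.
by move=> es; apply: sym_connect_sym => x y; rewrite /induced /= es andbCA.
Qed.

Lemma induced_connect_sub e D S : D \subset S ->
  subrel (connect (induced e D)) (connect (induced e S)).
Proof.
move=> /subsetP DS; apply: connect_sub => x y /and3P[xD yD exy].
by apply: connect1; rewrite /induced /= !DS.
Qed.

(** Two distinct neighbours of [j] in [D], joined by a simple path inside [D], would close up
    through [j] to a cycle of length at least 3. *)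
Lemma tree_unique_neighbor e D j i i' : is_tree e ->
  {in D &, forall x y, connect (induced e D) x y} -> j \notin D ->
  i \in D -> i' \in D -> e i j -> e i' j -> i' = i.
Proof.
move=> [[es ei] [_ _ ecyc]] Dc jD iD i'D eij ei'j.
have [//|ii'] := eqVneq i' i.
have /connectP[p pp lp] := Dc i i' iD i'D.
case/shortenP: pp lp => q pq uq _ lq.
have qD : all (mem D) q.
  elim: q i pq {iD eij ii' uq lq} => //= a q IH x /andP[/and3P[_ aD _] /IH ->].
  by rewrite aD.
suff /ecyc : ucycle (induced e [set: T]%SET) [:: j, i & q].
  by case: q lq {pq uq qD} => // lq; rewrite lq eqxx in ii'.
rewrite /ucycle cons_uniq uq inE /= rcons_path -lq /induced /= !inE /= es.
rewrite eij ei'j !andbT.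
apply/andP; split; last first.
  rewrite negb_or; apply/andP; split; first by apply: contraNneq jD => ->.
  by apply: contraNN jD => /(allP qD).
by apply: sub_path pq => x y /and3P[_ _ exy]; rewrite /= !inE.
Qed.

(** A component is grown from [r] by one leaf at a time. The uniqueness clause ties the new node to
    the old ones by a single edge, which is what allows laws to be glued edge by edge. *)
Lemma tree_component_ind e S r (P : {set T} -> Prop) : is_tree e ->
  let C := [set j | connect (induced e S) r j]%SET in
  P [set r]%SET ->
  (forall D i j, j |: D \subset C -> i \in D -> j \notin D -> e i j ->
     (forall i', i' \in D -> e i' j -> i' = i) -> P D -> P (j |: D)%SET) ->
  P C.
Proof.
move=> et C P0 PS; have [[es ei] _] := et.
pose good D := `[< [/\ D \subset C, r \in D,
  {in D, forall x, connect (induced e D) r x} & P D] >].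
(* A maximal admissible set is the whole component: otherwise some edge leaves it and its far end
   could be added. *)
have [|D /maxsetP[/asboolP[DC rD Dc PD] Dmax]] := @ex_maxset _ good.
  exists [set r]%SET; apply/asboolP; split=> //.
  - by rewrite sub1set inE connect0.
  - by rewrite inE.
  - by move=> x /set1P ->; rewrite connect0.
have [<- //|DnC] := eqVneq D C.
have [x xC xD] : exists2 x, x \in C & x \notin D.
  by apply/subsetPn; apply: contraNN DnC => CD; rewrite eqEsubset DC.
have rx : connect (induced e S) r x by rewrite inE in xC.
have [i [j [iD jD eij ri]]] := connect_exits rx rD xD.
have /and3P[_ _ eij'] := eij.
have jDC : j |: D \subset C.
  rewrite subUset sub1set DC andbT inE.
  by apply: connect_trans ri _; apply: connect1.
have sD : {in D &, forall x y, connect (induced e D) x y}.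
  move=> y z yD zD; apply: connect_trans (Dc z zD).
  by rewrite induced_connect_sym //; apply: Dc.
suff /Dmax E : good (j |: D)%SET.
  by move: jD; rewrite -(E (subsetUr _ _)) setU11.
have jDc y : y \in D -> connect (induced e (j |: D)%SET) r y.
  by move=> yD; apply: induced_connect_sub (Dc y yD); apply: subsetUr.
apply/asboolP; split=> //.
- by rewrite inE rD orbT.
- move=> y /setU1P[->|/jDc //].
  apply: connect_trans (jDc i iD) _; apply: connect1.
  by rewrite /induced /= setU11 !inE iD orbT.
- apply: (PS D i j) => // i' i'D ei'j.
  exact: (tree_unique_neighbor et sD jD iD i'D eij' ei'j).
Qed.

End Graph.

(** * Finite laws: coupling along a tree, determination by moments *)

Section Coupling.
Context {R : realType}.

(** If [f] exceeded its mean at every point of positive weight, non-negative terms would sum to 0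
    and all weights would vanish. The positive weight matters later: coupled samples are known to be
    consistent only there. *)
Lemma exists_le_mean (I : finType) (mu f : I -> R) :
  (forall s, 0 <= mu s) -> \sum_s mu s = 1 ->
  exists2 s, 0 < mu s & f s <= \sum_s mu s * f s.
Proof.
move=> mu0 mu1; set a := \sum_s _.
apply: contrapT => nex.
have lef s : 0 < mu s -> a < f s.
  by move=> s0; rewrite ltNge; apply/negP => le; apply: nex; exists s.
have d0 s : 0 <= mu s * (f s - a).
  have := mu0 s; rewrite le_eqVlt => /predU1P[<-|s0]; first by rewrite mul0r.
  by rewrite mulr_ge0 // subr_ge0 ltW // lef.
have dsum : \sum_s mu s * (f s - a) = 0.
  under eq_bigr do rewrite mulrBr.
  by rewrite sumrB -mulr_suml mu1 mul1r subrr.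
have mu_eq0 s : mu s = 0.
  apply/eqP; rewrite eq_le mu0 andbT leNgt; apply/negP => s0.
  have /eqP := psumr_eq0P (fun i _ => d0 i) dsum (i := s) isT.
  by rewrite mulf_eq0 (gt_eqF s0) /= subr_eq0 (gt_eqF (lef s s0)).
by move: mu1; rewrite big1 // => /esym/eqP; rewrite oner_eq0.
Qed.

Section Glue.
Context {I J : finType} {K : eqType} (mu : I -> R) (nu : J -> R).
Variables (f : I -> K) (g : J -> K).
Hypothesis mu0 : forall s, 0 <= mu s.
Hypothesis fg : forall x,
  \sum_s mu s * (f s == x)%:R = \sum_l nu l * (g l == x)%:R.

Let weight s l := mu s * nu l * (f s == g l)%:R / \sum_t mu t * (f t == f s)%:R.

Lemma glue_weight_ge0 s l : (forall t, 0 <= nu t) -> 0 <= weight s l.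
Proof.
move=> nu0; rewrite /weight divr_ge0 ?mulr_ge0 ?ler0n //.
by apply: sumr_ge0 => t _; rewrite mulr_ge0.
Qed.

(** By [fg] the class of [s] has the same mass under [nu], so the conditional weights add up to 1;
    if that mass is 0, so is [mu s]. *)
Lemma glue_weight_suml s : \sum_l weight s l = mu s.
Proof.
rewrite /weight; set m := \sum_t mu t * (f t == f s)%:R.
have -> : \sum_l mu s * nu l * (f s == g l)%:R / m = mu s * (m / m).
  rewrite [X in _ = _ * (X / _)](fg (f s)) mulrA mulr_sumr mulr_suml.
  by apply: eq_bigr => l _; rewrite mulrA eq_sym.
have [m0|m0] := eqVneq m 0; last by rewrite divff ?mulr1.
suff -> : mu s = 0 by rewrite mul0r.
have t0 t : true -> 0 <= mu t * (f t == f s)%:R by rewrite mulr_ge0.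
by have := psumr_eq0P t0 m0 (i := s) isT; rewrite eqxx mulr1.
Qed.

End Glue.

(* The two laws are coupled independently conditionally on [f s = g l]; a null
   class costs nothing, since 0 / 0 = 0. *)
Lemma glue (I J : finType) (K : eqType) (mu : I -> R) (nu : J -> R)
    (f : I -> K) (g : J -> K) :
  (forall s, 0 <= mu s) -> (forall l, 0 <= nu l) ->
  (forall x, \sum_s mu s * (f s == x)%:R = \sum_l nu l * (g l == x)%:R) ->
  exists rho : I -> J -> R, [/\ forall s l, 0 <= rho s l,
    forall s, \sum_l rho s l = mu s, forall l, \sum_s rho s l = nu l &
    forall s l, 0 < rho s l -> f s = g l].
Proof.
move=> mu0 nu0 fg.
exists (fun s l => mu s * nu l * (f s == g l)%:R / \sum_t mu t * (f t == f s)%:R).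
split=> [s l|s|l|s l].
- exact: glue_weight_ge0.
- exact: glue_weight_suml.
(* Column sums are row sums with the two laws exchanged; the normalisations agree where [f s = g l],
   again by [fg]. *)
- rewrite -[RHS](glue_weight_suml nu0 (fun x => esym (fg x)) l).
  apply: eq_bigr => s _; rewrite (mulrC (mu s)) (eq_sym (g l)).
  by have [->|_] := eqVneq (f s) (g l); rewrite ?fg // !mulr0 !mul0r.
- by have [//|_] := eqVneq (f s) (g l); rewrite mulr0 mul0r ltxx.
Qed.

(* [a i l] is the [l]-th atom of the law attached to the node [i], with weight
   [lam i l]; a coupling is a family of random variables [Y _ i] on one finite
   space with these laws. *)
Lemma tree_coupling (T : finType) (e : rel T) (S : {set T}) (r : T)
    (A : Type) (K : eqType) (J : T -> finType) (lam : forall i, J i -> R)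
    (a : forall i, J i -> A) (key : T -> T -> A -> K) :
  let C := [set j | connect (induced e S) r j]%SET in
  is_tree e ->
  (forall i l, 0 <= lam i l) ->
  (forall i j b, key i j b = key j i b) ->
  (forall i j, i \in C -> j \in C -> e i j -> forall x,
    \sum_l lam i l * (key i j (a i l) == x)%:R =
    \sum_l lam j l * (key i j (a j l) == x)%:R) ->
  exists (I : finType) (mu : I -> R) (Y : I -> T -> A),
    [/\ forall s, 0 <= mu s,
        forall i, i \in C -> forall g : A -> R,
          \sum_s mu s * g (Y s i) = \sum_l lam i l * g (a i l),
        forall s i, i \in C -> exists l, Y s i = a i l &
        forall s, 0 < mu s -> forall i j, i \in C -> j \in C -> e i j ->
          key i j (Y s i) = key i j (Y s j)].
Proof.
move=> C et lam0 keyC law; have [[es ei] _] := et.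
pattern C; apply: (tree_component_ind et) => [|D i j jDC iD jD eij uniq_i].
  exists (J r), (lam r), (fun l _ => a r l); split=> //.
  - by move=> i /set1P ->.
  - by move=> s i /set1P ->; exists s.
have CD t : t \in D -> t \in C by move=> tD; rewrite (subsetP jDC) // setU1r.
have jC : j \in C by rewrite (subsetP jDC) // setU11.
move=> [I [mu [Y [mu0 marg supp agree]]]].
have fg x : \sum_s mu s * (key i j (Y s i) == x)%:R =
            \sum_l lam j l * (key i j (a j l) == x)%:R.
  rewrite (marg i iD (fun b => (key i j b == x)%:R)).
  exact: law (CD i iD) jC eij x.
have [rho [rho0 rhol rhor rhoE]] := glue mu0 (lam0 j) fg.
have neqj t : t \in D -> (t == j) = false.
  by move=> tD; apply: contraNF jD => /eqP <-.
(* The new node reads the second coordinate, the old ones the first. Only the edge from [i] to [j]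
   needs a new agreement, and [rho] provides it. *)
exists (I * J j)%type, (fun s => rho s.1 s.2),
  (fun s t => if t == j then a j s.2 else Y s.1 t); split.
- by move=> s.
- move=> t /setU1P[->|tD] g.
    rewrite eqxx -(pair_bigA _ (fun s l => rho s l * g (a j l))) exchange_big /=.
    by apply: eq_bigr => l _; rewrite -mulr_suml rhor.
  rewrite neqj // -(pair_bigA _ (fun s l => rho s l * g (Y s t))) /= -marg //.
  by apply: eq_bigr => s _; rewrite -mulr_suml rhol.
- move=> s t /setU1P[->|tD]; first by rewrite eqxx; exists s.2.
  by rewrite neqj //; apply: supp.
- move=> [s l] /= rho_gt0.
  have mus : 0 < mu s.
    rewrite -rhol; apply: lt_le_trans rho_gt0 _.
    by rewrite (bigD1 l) //= lerDl sumr_ge0.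
  move=> t u /setU1P[->|tD] /setU1P[->|uD]; rewrite ?eqxx ?ei //.
  + rewrite es => euj; rewrite neqj // keyC [RHS]keyC (uniq_i u) //.
    by rewrite (rhoE s l).
  + by move=> etj; rewrite neqj // (uniq_i t) // (rhoE s l).
  + by rewrite !neqj //; apply: agree.
Qed.

(** Moebius inversion on subsets: the upper sum at [U] determines [f U] once the values at larger
    sets are known, so the induction descends from the full set. *)
Lemma eq_upper_sums (V : finType) (f g : {set V} -> R) (B : {set V}) :
  (forall U : {set V}, ~~ (U \subset B) -> f U = g U) ->
  (forall S : {set V}, S \subset B -> \sum_U f U * (S \subset U)%:R =
    \sum_U g U * (S \subset U)%:R) ->
  f =1 g.
Proof.
move=> out mom U.
have [n] := ubnP #|~: U|; elim: n U => // n IH U leU.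
have [UB|/out //] := boolP (U \subset B).
have := mom U UB; rewrite (bigD1 U) // [X in _ = X](bigD1 U) //= subxx !mulr1.
rewrite (eq_bigr (fun S => g S * (U \subset S)%:R)); first by move/addIr.
move=> S SU; have [US|_] := boolP (U \subset S); last by rewrite !mulr0.
rewrite IH // -ltnS (leq_trans _ leU) // ltnS proper_card //.
by rewrite properEneq setCS US andbT (inj_eq (@setC_inj _)).
Qed.

End Coupling.

(** * Block solutions and the laws that represent points of their hull *)

Section Blocks.
Context {R : realType} {n m : nat} {T : finType}.
Context (P : mip n m) (Q : T -> {set 'I_n}) (asg : 'I_m -> T).

(** Extension by 0 to all variables lets copies in different bags be compared without dependent
    types. *)
Definition extend i (x : xvec R Q i) (v : 'I_n) : R :=
  if insub v is Some u then x u else 0.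

Definition restrict i (y : 'I_n -> R) : xvec R Q i := [ffun u => y (val u)].

Lemma extend_val i (x : xvec R Q i) u : extend x (val u) = x u.
Proof. by rewrite /extend valK. Qed.

Lemma extendK i : cancel (@extend i) (@restrict i).
Proof. by move=> x; apply/ffunP => u; rewrite ffunE extend_val. Qed.

Lemma block_feasible_ge0 i (x : xvec R Q i) u :
  block_feasible P asg x -> 0 <= (x u : R).
Proof.
move=> [_ bin pos]; have [/bin[]->|/pos //] := boolP (val u \in mip_bin P).
  by rewrite lexx.
by rewrite ler01.
Qed.

(** With [A] and [x] non-negative, zeroing entries only lowers the left-hand sides, and 0 is
    admissible for binary and continuous variables alike. *)
Lemma packing_block_feasible (c : forall i, xvec R Q i) i (x x' : xvec R Q i) :
  packing P c -> block_feasible P asg x ->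
  (forall u, x' u = 0 \/ x' u = x u) -> block_feasible P asg x'.
Proof.
move=> [_ A0 _] fx x'E; have [Ax bin pos] := fx.
split=> [r /Ax|u ub|u ub].
- apply: le_trans; apply: ler_sum => u _; rewrite ler_wpM2l ?ler0q ?A0 //.
  by have [->|->] := x'E u => //; apply: block_feasible_ge0 fx.
- by have [->|->] := x'E u; [left|apply: bin].
- by have [->|->] := x'E u; [|apply: pos].
Qed.

Lemma packing_zero_feasible (c : forall i, xvec R Q i) i :
  packing P c -> block_feasible P asg (0 : xvec R Q i).
Proof.
move=> [_ _ b0]; split=> [r _|u _|u _].
- rewrite big1 ?ler0q ?b0 // => u _.
  by rewrite ffunE mulr0.
- by left; rewrite ffunE.
- by rewrite ffunE.
Qed.

Lemma prod_extend i (x : xvec R Q i) (S : {set 'I_n}) : S \subset Q i ->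
  \prod_(u : bag Q i | val u \in S) (x u : R) = \prod_(v in S) extend x v.
Proof.
move=> /fintype.subsetP SQ.
rewrite [RHS](reindex_omap val (insub : 'I_n -> option (bag Q i))).
  by apply: eq_big => [u|u _]; rewrite ?valK ?eqxx ?andbT ?extend_val.
by move=> v /SQ vQ; rewrite insubT.
Qed.

(* A finitely supported law on [R^n]: number of atoms, weights, atoms. *)
Definition law := {p : nat & ('I_p -> R) * ('I_p -> 'I_n -> R)}%type.
Definition weight (d : law) : 'I_(projT1 d) -> R := (projT2 d).1.
Definition atom (d : law) : 'I_(projT1 d) -> 'I_n -> R := (projT2 d).2.
Arguments weight : clear implicits.
Arguments atom : clear implicits.

(** A hull point is read as the expectation of a random feasible block solution: [z.1] is its mean
    and [z.2] collects its mixed moments. *)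
Record represents i (z : xvec R Q i * wvec R Q i) (d : law) : Prop :=
  Represents {
    weight_ge0 : forall l, 0 <= weight d l;
    weight_sum1 : \sum_l weight d l = 1;
    atom_feasible : forall l, block_feasible P asg (restrict i (atom d l));
    law_mean : forall u, z.1 u = \sum_l weight d l * atom d l (val u);
    law_moment : forall S : subbag Q i,
      z.2 S = \sum_l weight d l * \prod_(v in val S) atom d l v }.

Lemma conv_block_law i (z : xvec R Q i * wvec R Q i) :
  conv (block_feasibleM P asg (i := i)) z -> exists d, represents z d.
Proof.
move=> [p [lam [y [lam0 lam1 yM ->]]]].
exists (existT _ p (lam, fun l => extend (y l).1)); split => //= [l|u|S].
- by rewrite extendK; case: (yM l).
- rewrite (raddf_sum fst) /= sum_ffunE; apply: eq_bigr => l _.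
  rewrite ffunE; congr (_ * _); exact/esym/extend_val.
- rewrite (raddf_sum snd) /= sum_ffunE; apply: eq_bigr => l _.
  rewrite ffunE; have [_ ->] := yM l.
  by congr (_ * _); apply: prod_extend (valP S).
Qed.


End Blocks.
Arguments weight {R n} d.
Arguments atom {R n} d.

(** * Cheap solutions on the components of a good set *)

Section Components.
Context {R : realType} {n m : nat} {T : finType}.
Context (P : mip n m) (e : rel T) (Q : T -> {set 'I_n}) (asg : 'I_m -> T).
Context (c : forall i : T, xvec R Q i) (k : nat).
Context (z : forall i, xvec R Q i * wvec R Q i) (d : T -> law (R := R) (n := n)).
Hypothesis Ptree : tree_decomposition (intersection_graph P) e Q.
Hypothesis Pbin : binary_interfaces P e Q.
Hypothesis zd : forall i, represents P asg (z i) (d i).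
Hypothesis zfeas : dualM_feasible P e asg k z.

Lemma atom_binary i l v : v \in Q i -> v \in mip_bin P ->
  atom (d i) l v = 0 \/ atom (d i) l v = 1.
Proof.
move=> vQ vb; have [_ /(_ (Sub v vQ) vb)] := atom_feasible (zd i) l.
by rewrite ffunE.
Qed.

Lemma dual_moment i j (S : {set 'I_n}) : e i j ->
  S \subset Q i :&: Q j -> (#|S| <= k)%N ->
  \sum_l weight (d i) l * \prod_(v in S) atom (d i) l v =
  \sum_l weight (d j) l * \prod_(v in S) atom (d j) l v.
Proof.
move=> eij; rewrite subsetI => /andP[Si Sj] Sk.
have := zfeas.2 i j eij (exist _ S Si) (exist _ S Sj) erefl Sk.
by rewrite !(law_moment (zd _)).
Qed.

Lemma sub_prod_indicator (V : finType) (S B : {set V}) (y : V -> R) :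
  S \subset B -> {in B, forall v, y v = 0 \/ y v = 1} ->
  \prod_(v in S) y v = (S \subset [set v in B | y v == 1])%:R.
Proof.
move=> /fintype.subsetP SB y01.
case: fintype.subsetP => [S1|nS1].
  by rewrite big1 // => v /S1; rewrite inE => /andP[_ /eqP].
apply/eqP/prodf_eq0; apply: contrapT => nex; apply: nS1 => v vS.
rewrite inE SB //=; have [v0|->//] := y01 v (SB v vS).
by case: nex; exists v => //; rewrite v0.
Qed.

(** For binary entries the moment of [S] is the probability that the set of ones contains [S], hence
    an upper sum of the law of that set. *)
Lemma pattern_moment (V J : finType) (lam : J -> R) (y : J -> V -> R)
    (S B : {set V}) :
  S \subset B -> (forall l, {in B, forall v, y l v = 0 \/ y l v = 1}) ->
  \sum_(U : {set V})
     (\sum_l lam l * ([set v in B | y l v == 1]%SET == U)%:R) * (S \subset U)%:R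
  = \sum_l lam l * \prod_(v in S) y l v.
Proof.
move=> SB y01; under eq_bigr do rewrite mulr_suml.
rewrite exchange_big; apply: eq_bigr => l _ /=.
rewrite (sub_prod_indicator SB (y01 l)).
rewrite (bigD1 [set v in B | y l v == 1]%SET) //= eqxx mulr1.
rewrite big1 ?addr0 // => U /negPf nU.
by rewrite eq_sym nU mulr0 mul0r.
Qed.

(** The gluing key: binary values on the [W]-part of an interface, encoded by their set of ones. *)
Definition pattern (W : {set 'I_n}) i j (y : 'I_n -> R) : {set 'I_n} :=
  [set v in Q i :&: Q j :&: W | y v == 1]%SET.

(** Every subset of the [W]-part has at most [k] elements, so the dual equates all its moments, and
    these determine the law by inversion. *)
Lemma pattern_law (W : {set 'I_n}) i j : e i j ->
  (#|Q i :&: Q j :&: W| <= k)%N -> forall U,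
  \sum_l weight (d i) l * (pattern W i j (atom (d i) l) == U)%:R =
  \sum_l weight (d j) l * (pattern W i j (atom (d j) l) == U)%:R.
Proof.
move=> eij Wk; set B := Q i :&: Q j :&: W.
have BQ : B \subset Q i :&: Q j by apply: subsetIl.
have y01 t l : B \subset Q t ->
    {in B, forall v, atom (d t) l v = 0 \/ atom (d t) l v = 1}.
  move=> /fintype.subsetP Bt v vB; apply: atom_binary; first exact: Bt.
  by apply: (fintype.subsetP (Pbin eij)); apply: (fintype.subsetP BQ).
have Bi : B \subset Q i by apply: subset_trans BQ (subsetIl _ _).
have Bj : B \subset Q j by apply: subset_trans BQ (subsetIr _ _).
apply: (@eq_upper_sums _ _ _ _ B) => [U UB|S SB].
  (* Patterns are subsets of [B], so any other [U] has probability 0 on both sides. *)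
  rewrite !big1 // => l _; rewrite /pattern -/B; case: eqP UB => [<-|_ _];
    rewrite ?mulr0 //; move/negP; case; apply/fintype.subsetP => v;
    by rewrite inE => /andP[].
rewrite !(pattern_moment _ SB) => [|l|l]; [|exact: y01|exact: y01].
apply: dual_moment => //; first exact: subset_trans BQ.
exact: leq_trans (subset_leq_card SB) Wk.
Qed.

Definition block_cost (W : {set 'I_n}) i (y : 'I_n -> R) : R :=
  \sum_(u : bag Q i | val u \in W) c i u * y (val u).

(** Consistency is asked on [W] only, since the other entries will be set to 0. *)
Definition component_solution (W : {set 'I_n}) (C : {set T}) :=
  exists y : T -> 'I_n -> R,
    [/\ forall i, i \in C -> block_feasible P asg (restrict Q i (y i)),
        forall i j v, i \in C -> j \in C -> e i j ->
          v \in Q i -> v \in Q j -> v \in W -> y i v = y j v &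
        \sum_(i in C) block_cost W i (y i)
          <= \sum_(i in C) block_cost W i (extend (z i).1)].

Lemma mean_block_cost (W : {set 'I_n}) i (J : finType) (mu : J -> R)
    (y : J -> 'I_n -> R) :
  \sum_s mu s * block_cost W i (y s) =
  block_cost W i (fun v => \sum_s mu s * y s v).
Proof.
rewrite /block_cost; under eq_bigr do rewrite mulr_sumr.
rewrite exchange_big; apply: eq_bigr => u _ /=; rewrite mulr_sumr.
by apply: eq_bigr => s _; rewrite mulrCA.
Qed.

Lemma eq_block_cost (W : {set 'I_n}) i (y y' : 'I_n -> R) :
  (forall v, v \in Q i -> v \in W -> y v = y' v) ->
  block_cost W i y = block_cost W i y'.
Proof. by move=> yy; apply: eq_bigr => u uW; rewrite yy // (valP u). Qed.

Lemma sample_cost (W : {set 'I_n}) (C : {set T}) (J : finType) (mu : J -> R)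
    (y : J -> T -> 'I_n -> R) :
  (forall s, 0 <= mu s) -> \sum_s mu s = 1 ->
  (forall i v, i \in C -> v \in Q i -> v \in W ->
     \sum_s mu s * y s i v = extend (z i).1 v) ->
  exists2 s, 0 < mu s & \sum_(i in C) block_cost W i (y s i)
     <= \sum_(i in C) block_cost W i (extend (z i).1).
Proof.
move=> mu0 mu1 yz.
have [s s0 le] :=
  exists_le_mean (fun s => \sum_(i in C) block_cost W i (y s i)) mu0 mu1.
exists s => //; apply: le_trans le _.
under eq_bigr do rewrite mulr_sumr.
rewrite exchange_big; apply: ler_sum => i iC /=.
rewrite mean_block_cost le_eqVlt; apply/orP; left; apply/eqP.
by apply: eq_block_cost => v vQ vW; apply: yz.
Qed.

Lemma law_mean_extend i v : v \in Q i ->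
  extend (z i).1 v = \sum_l weight (d i) l * atom (d i) l v.
Proof.
move=> vQ; rewrite -[v]/(val (Sub v vQ : bag Q i)) extend_val.
exact: (law_mean (zd i)).
Qed.

(** The block laws are coupled with interface patterns as keys. The marginals keep the means, so
    some sample of positive weight costs at most the mean. *)
Lemma narrow_component_solution (W : {set 'I_n}) (S : {set T}) r :
  let C := [set j | connect (induced e S) r j]%SET in
  (forall i j, i \in C -> j \in C -> e i j -> (#|Q i :&: Q j :&: W| <= k)%N) ->
  component_solution W C.
Proof.
move=> C Ck; have [et _ _ _] := Ptree.
have keyC i j y : pattern W i j y = pattern W j i y.
  by rewrite /pattern (setIC (Q i)).
have [I [mu [Y [mu0 marg supp agree]]]] :=
  @tree_coupling _ _ e S r _ _ _ _ (fun i l => atom (d i) l) (pattern W) et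
    (fun i => weight_ge0 (zd i)) keyC
    (fun i j iC jC eij => pattern_law eij (Ck i j iC jC eij)).
have rC : r \in C by rewrite inE connect0.
have mu1 : \sum_s mu s = 1.
  have := marg r rC (fun=> 1); under eq_bigr do rewrite mulr1.
  by move=> ->; under eq_bigr do rewrite mulr1; apply: weight_sum1 (zd r).
have [s s0 le] : exists2 s, 0 < mu s & \sum_(i in C) block_cost W i (Y s i)
     <= \sum_(i in C) block_cost W i (extend (z i).1).
  apply: sample_cost => // i v iC vQ _.
  by rewrite (marg i iC (fun y => y v)) law_mean_extend.
exists (Y s); split=> // [i iC|i j v iC jC eij vi vj vW].
  by have [l ->] := supp s i iC; apply: atom_feasible (zd i) l.
(* Interface values are 0 or 1, so equal patterns force equal values at [v]. *)
have vb : v \in mip_bin P.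
  by apply: (fintype.subsetP (Pbin eij)); rewrite inE vi.
have := agree s s0 i j iC jC eij; move/setP/(_ v); rewrite !inE vi vj vW /=.
have [li ->] := supp s i iC; have [lj ->] := supp s j jC.
have [->|->] := atom_binary li vi vb; have [->|->] := atom_binary lj vj vb => //.
  by rewrite eqxx eq_sym oner_eq0.
by rewrite eqxx eq_sym oner_eq0.
Qed.

(** The nodes whose bags contain [v] induce a subtree, along which equalities on edges propagate. *)
Lemma copies_agree (U : Type) (f : T -> U) i j v :
  (forall a b, e a b -> v \in Q a -> v \in Q b -> f a = f b) ->
  v \in Q i -> v \in Q j -> f i = f j.
Proof.
move=> fE vi vj; have [_ sub _ _] := Ptree; have [_ con _] := sub v.
apply: connect_invariant (con i j _ _); rewrite ?inE //.
by move=> a b /and3P[]; rewrite !inE => va vb eab; apply: fE.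
Qed.

(** Since [k] is at least 1, singletons are among the dualized sets, so means agree across edges. *)
Lemma dual_copies_agree i j v : (1 <= k)%N -> v \in Q i -> v \in Q j ->
  extend (z i).1 v = extend (z j).1 v.
Proof.
move=> k1; apply: (copies_agree (f := fun t => extend (z t).1 v)).
move=> a b eab va vb; rewrite !law_mean_extend //.
have := @dual_moment a b [set v]%SET eab; rewrite sub1set inE va vb cards1.
move=> /(_ isT k1); under eq_bigr do rewrite big_set1.
by under [in RHS]eq_bigr do rewrite big_set1.
Qed.

(** The hub's bag contains every [W]-variable of the component, so a cheap atom of the hub fixes the
    whole [W]-cost; recourse extends this atom to a consistent solution. *)
Lemma hub_component_solution (W : {set 'I_n}) (C : {set T}) i :
  (1 <= k)%N -> relatively_complete_recourse R P e Q asg ->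
  i \in C -> (forall j, j \in C -> Q j :&: W \subset Q i :&: W) ->
  component_solution W C.
Proof.
move=> k1 rec iC hub.
have inQi j v : j \in C -> v \in Q j -> v \in W -> v \in Q i.
  move=> jC vj vW; have /fintype.subsetP/(_ v) := hub j jC.
  by rewrite !inE vj vW => /(_ isT)/andP[].
have [l l0 le] : exists2 l, 0 < weight (d i) l &
    \sum_(j in C) block_cost W j (atom (d i) l)
     <= \sum_(j in C) block_cost W j (extend (z j).1).
  (* Every node of the component reads the hub's atom; its mean is right at [j] because copies of a
     variable have equal dual values. *)
  apply: (sample_cost (y := fun l _ => atom (d i) l)).
  - exact: weight_ge0 (zd i).
  - exact: weight_sum1 (zd i).
  - move=> j v jC vj vW; have vi := inQi j v jC vj vW.
    by rewrite -law_mean_extend // (dual_copies_agree k1 vi vj).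
have [x [xF xE] xi] := rec i _ (atom_feasible (zd i) l).
have agr a b : e a b -> forall v, v \in Q a -> v \in Q b ->
    extend (x a) v = extend (x b) v.
  move=> eab v va vb; have := xE a b eab (Sub v va) (Sub v vb) erefl.
  by rewrite -!extend_val.
exists (fun j => extend (x j)); split=> [j jC|a b v _ _ eab va vb _|].
- by rewrite extendK.
- exact: agr.
- apply: le_trans le; rewrite le_eqVlt; apply/orP; left; apply/eqP.
  apply: eq_bigr => j jC; apply: eq_block_cost => v vj vW.
  have vi := inQi j v jC vj vW.
  rewrite (@copies_agree _ (fun t => extend (x t) v) j i v) //; last first.
    by move=> a b /agr; apply.
  by rewrite xi -[v]/(val (Sub v vi : bag Q i)) extend_val ffunE.
Qed.

Lemma good_component_solution (W : {set 'I_n}) r :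
  (1 <= k)%N -> relatively_complete_recourse R P e Q asg -> good e Q k W ->
  component_solution W (component e Q W r).
Proof.
move=> k1 rec /forall_inP gW; have [[[_ ei] _] _ _ _] := Ptree.
have [/gW/orP[/forall_inP narrow|/exists_inP[i iC /forall_inP hub]]|rS] :=
  boolP (r \in support_nodes Q W).
- apply: narrow_component_solution => i j iC jC eij.
  by have /forall_inP/(_ j jC)/implyP := narrow i iC; apply.
- exact: hub_component_solution hub.
(* Outside the support the component is the single node [r], which carries no edge. Covering this
   case gives a solution for every [r], as the later choice requires. *)
- apply: narrow_component_solution => i j.
  suff rE t : connect (induced e (support_nodes Q W)) r t -> t = r.
    by rewrite !inE => /rE -> /rE ->; rewrite ei.
  case/connectP=> [[|a p] /= pp ->] //.
  by case/andP: pp => /and3P[]; rewrite (negPf rS).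
Qed.

Lemma good_solution (W : {set 'I_n}) :
  (1 <= k)%N -> packing P c -> relatively_complete_recourse R P e Q asg ->
  good e Q k W ->
  exists2 x : forall i, xvec R Q i, tree_feasible P e asg x &
    objective c x <= \sum_i block_cost W i (extend (z i).1).
Proof.
move=> k1 pack rec gW; have [[[es ei] _] _ _ _] := Ptree.
have [y yP] := choice (fun r => good_component_solution r k1 rec gW).
pose S := support_nodes Q W; pose rt := fingraph.root (induced e S).
have csym : connect_sym (induced e S) by apply: induced_connect_sym.
have rtC i : i \in component e Q W (rt i).
  by rewrite inE csym connect_root.
(* Each node follows the solution chosen for the root of its component, zeroed outside [W]. *)
pose x i : xvec R Q i := [ffun u => if val u \in W then y (rt i) i (val u) else 0].
exists x.
  split=> [i|i j eij u u' uu'].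
    have [yF _ _] := yP (rt i).
    apply: (packing_block_feasible pack (yF i (rtC i))) => u.
    by rewrite !ffunE; case: ifP; [right|left].
  rewrite !ffunE -uu'; case: ifP => // uW.
  have ui : val u \in Q i := valP u.
  have uj : val u \in Q j by rewrite uu'; apply: (valP u').
  (* Both bags contain a common variable of [W], so the edge lies inside one component. *)
  have rij : rt i = rt j.
    apply/eqP; rewrite root_connect //; apply: connect1.
    rewrite /induced /= eij !inE !andbT; apply/andP.
    by split; apply/set0Pn; exists (val u); rewrite inE ?ui ?uj.
  have [_ yE _] := yP (rt i); rewrite -rij; apply: yE => //; rewrite rij; exact: rtC.
rewrite /objective.
have -> : \sum_i \sum_(u : bag Q i) c i u * x i u =
          \sum_i block_cost W i (y (rt i) i).
  apply: eq_bigr => i _; rewrite /block_cost [RHS]big_mkcond.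
  by apply: eq_bigr => u _; rewrite ffunE; case: ifP; rewrite ?mulr0.
rewrite (partition_big rt xpredT) //= [leRHS](partition_big rt xpredT) //=.
(* Costs are compared component by component; an [r] that is not its own root indexes an empty
   class. *)
apply: ler_sum => r _; have [rr|rr] := eqVneq (rt r) r; last first.
  rewrite !big_pred0 // => j; apply: contraNF rr => /eqP <-;
  by rewrite /rt root_root.
have [_ _ le] := yP r.
have CE i : (rt i == r) = (i \in component e Q W r).
  by rewrite inE -{1}rr root_connect // csym.
rewrite !(eq_bigl _ _ CE); apply: le_trans le.
by rewrite le_eqVlt; apply/orP; left; apply/eqP/eq_bigr => i;
   rewrite -CE => /eqP ->.
Qed.

End Components.

(** * Good sets and fractional covers *)

Lemma good_set1 {n : nat} {T : finType} (e : rel T) (Q : T -> {set 'I_n})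
    (k : nat) (v : 'I_n) : (1 <= k)%N -> good e Q k [set v]%SET.
Proof.
move=> k1; apply/forall_inP => i _ /=; apply/orP; left.
apply/forall_inP => j _; apply/forall_inP => l _; apply/implyP => _.
apply: leq_trans k1; rewrite -(cards1 v); apply: subset_leq_card.
exact: subsetIr.
Qed.

(** Covering a single variable already takes total weight 1, and [0 < n] supplies one. The resulting
    positivity of eta settles the case of an infinite optimum. *)
Lemma eta_cover_ge1 (R : realType) {n : nat} {T : finType} (e : rel T)
    (Q : T -> {set 'I_n}) (k : nat) : (0 < n)%N ->
  (1 <= eta_cover R e Q k)%E.
Proof.
move=> n0; apply/ereal_infP => _ [alpha [a0 a1] <-].
rewrite lee_fin; apply: le_trans (a1 (Ordinal n0)) _.
apply: ler_sum => W gW; rewrite -[leRHS]mulr1 ler_wpM2l ?a0 //.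
by case: (_ \in _).
Qed.

Lemma singleton_cover (R : realType) {n : nat} {T : finType} (e : rel T)
    (Q : T -> {set 'I_n}) (k : nat) : (1 <= k)%N ->
  exists alpha : {set 'I_n} -> R, fractional_good_cover e Q k alpha.
Proof.
move=> k1; exists (fun=> 1); split=> // v.
rewrite (bigD1 [set v]%SET) ?good_set1 //= inE eqxx mulr1 lerDl.
by apply: sumr_ge0 => W _; rewrite mul1r ler0n.
Qed.

(** * The two inequalities between the optimum and the dual *)

Section Bounds.
Context {R : realType} {n m : nat} {T : finType}.
Context (P : mip n m) (e : rel T) (Q : T -> {set 'I_n}) (asg : 'I_m -> T).
Context (c : forall i : T, xvec R Q i) (k : nat).

(** A feasible solution together with its own products is a one-atom convex combination, and
    consistent copies have equal products. *)
Lemma DUALM_le_OPT : (DUALM P e asg c k <= OPT P e asg c)%E.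
Proof.
apply/ereal_infP => _ [x [xF xE] <-].
apply: ereal_inf_lbound.
pose w i : wvec R Q i :=
    [ffun S : subbag Q i => (\prod_(u : bag Q i | val u \in val S) (x i u : R) : R^o)].
exists (fun i => (x i, w i)) => //; split=> [i|i j eij S S' SS' _] /=.
  exists 1%N, (fun=> 1), (fun=> (x i, w i)); split=> //.
  - by rewrite big_ord1.
  - by split=> // S; rewrite ffunE.
  - by rewrite big_ord1 scale1r.
rewrite !ffunE !prod_extend ?(valP S) ?(valP S') // -SS'.
apply: eq_bigr => v vS.
have vi : v \in Q i := fintype.subsetP (valP S) v vS.
have vj : v \in Q j by apply: (fintype.subsetP (valP S')); rewrite -SS'.
have := xE i j eij (Sub v vi) (Sub v vj) erefl.
by rewrite -!extend_val.
Qed.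

Lemma OPT_le0 : packing P c -> (OPT P e asg c <= 0)%E.
Proof.
move=> pack; apply: ereal_inf_lbound; exists (fun=> 0).
  split=> [i|i j _ u u' _]; last by rewrite !ffunE.
  exact: packing_zero_feasible pack.
congr EFin; apply: big1 => i _; apply: big1 => u _.
by rewrite ffunE mulr0.
Qed.

(** Each good set bounds its part of the dual cost below by [r]; the bounds are averaged with
    weights [alpha]. *)
Lemma cover_objective (z : forall i, xvec R Q i * wvec R Q i)
    (alpha : {set 'I_n} -> R) (r : R) :
  tree_decomposition (intersection_graph P) e Q -> binary_interfaces P e Q ->
  packing P c -> relatively_complete_recourse R P e Q asg -> (1 <= k)%N ->
  dualM_feasible P e asg k z -> fractional_good_cover e Q k alpha ->
  OPT P e asg c = r%:E ->
  (\sum_(W | good e Q k W) alpha W) * r <= objective c (fun i => (z i).1).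
Proof.
move=> td bin pack rec k1 zF [a0 a1] optE.
have [d zd] := choice (fun i => conv_block_law (zF.1 i)).
have [c0 _ _] := pack.
have costW W : good e Q k W ->
    r <= \sum_i block_cost c W i (extend (z i).1).
  move=> gW; have [x xF le] := good_solution td bin zd zF k1 pack rec gW.
  rewrite -lee_fin -optE; apply: le_trans (_ : (objective c x)%:E <= _)%E.
    by apply: ereal_inf_lbound; exists x.
  by rewrite lee_fin.
have z0 i u : 0 <= ((z i).1 u : R).
  rewrite (law_mean (zd i)); apply: sumr_ge0 => l _.
  rewrite mulr_ge0 ?(weight_ge0 (zd i)) //.
  by have := block_feasible_ge0 u (atom_feasible (zd i) l); rewrite ffunE.
apply: le_trans (_ : \sum_(W | good e Q k W) alpha W *
    \sum_i block_cost c W i (extend (z i).1) <= _).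
  rewrite mulr_suml; apply: ler_sum => W gW.
  by rewrite ler_wpM2l ?a0 // costW.
under eq_bigr do rewrite mulr_sumr.
rewrite exchange_big; apply: ler_sum => i _ /=.
rewrite /block_cost.
under eq_bigr do rewrite mulr_sumr big_mkcond.
rewrite exchange_big; apply: ler_sum => u _ /=.
have -> : \sum_(W | good e Q k W) (if val u \in W then
      alpha W * (c i u * extend (z i).1 (val u)) else 0) =
    c i u * (z i).1 u * \sum_(W | good e Q k W) alpha W * (val u \in W)%:R.
  rewrite mulr_sumr; apply: eq_bigr => W _; rewrite extend_val.
  by case: ifP => _; rewrite ?mulr0 // mulr1 mulrC.
(* The factor [c i u * (z i).1 u] is non-positive, so lowering the coverage to 1 can only raise the
   product. *)
rewrite -[leRHS]mulr1; apply: ler_wnM2l; last exact: a1.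
exact: mulr_le0_ge0.
Qed.

Lemma eta_OPT_le_DUALM :
  tree_decomposition (intersection_graph P) e Q -> binary_interfaces P e Q ->
  packing P c -> relatively_complete_recourse R P e Q asg ->
  (1 <= k)%N -> (0 < n)%N ->
  (eta_cover R e Q k * OPT P e asg c <= DUALM P e asg c k)%E.
Proof.
move=> td bin pack rec k1 n0.
have eta1 := eta_cover_ge1 R e Q k n0.
have eta0 : (0 < eta_cover R e Q k)%E by apply: lt_le_trans eta1.
apply/ereal_infP => _ [z zF <-].
(* If the optimum is minus infinity, so is its product with the positive eta. *)
have := OPT_le0 pack; case optE : (OPT P e asg c) => [r| |] // r0; last first.
  by rewrite gt0_muleNy // leNye.
have cov alpha (aC : fractional_good_cover e Q k alpha) :=
  cover_objective td bin pack rec k1 zF aC optE.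
rewrite lee_fin le_eqVlt in r0; case/predU1P: r0 => [rE|r0].
  (* An infinite eta would say nothing here, as +oo * 0 = 0. *)
  have [alpha /cov] := singleton_cover R e Q k1.
  by rewrite rE mulr0 mule0 lee_fin.
(* Division by the negative [r] turns the estimate into a lower bound on the weight of every cover,
   hence on the infimum. *)
have etaLB : ((objective c (fun i => (z i).1) / r)%:E <= eta_cover R e Q k)%E.
  apply/ereal_infP => _ [alpha /cov le <-].
  by rewrite lee_fin ler_ndivrMr.
move: eta0 etaLB; case: (eta_cover R e Q k) => [h| |] // _.
  by rewrite -EFinM !lee_fin ler_ndivrMr.
by rewrite lt0_mulye ?lte_fin // leNye.
Qed.

End Bounds.

Theorem theorem9 (R : realType) (n m : nat) (P : mip n m)
    (T : finType) (e : rel T) (Q : T -> {set 'I_n})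
    (asg : 'I_m -> T) (c : forall i : T, xvec R Q i) (k : nat) :
  tree_decomposition (intersection_graph P) e Q ->
  assignment P Q asg ->
  objective_split P c ->
  binary_interfaces P e Q ->
  packing P c ->
  relatively_complete_recourse R P e Q asg ->
  (1 <= k <= n)%N ->
  (eta_cover R e Q k * OPT P e asg c <= DUALM P e asg c k)%E /\
  (DUALM P e asg c k <= OPT P e asg c)%E.
Proof.
move=> td _ _ bin pack rec /andP[k1 kn]; split; last exact: DUALM_le_OPT.
by apply: eta_OPT_le_DUALM => //; apply: leq_trans kn.
Qed.
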